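(* Let $\psi=\psi(s)$ be a unit speed spacelike curve in $E_1^3$, parameterized by arclength $s$, with spacelike or timelike principal normal, with Frenet frame $\{T,N,B\}$, curvature $\kappa$ (nowhere zero), torsion $\tau$ (nowhere zero), and $\varepsilon=g(N,N)\in\{1,-1\}$. Let $\psi=\psi(\theta)$ be the reparametrization of this curve by the parameter $\theta=\int\kappa(s)\,ds$, and put $f(\theta)=\frac{\tau(\theta)}{\kappa(\theta)}$. Then the tangent vector $T$, regarded as a function of $\theta$, satisfies the third-order vector differential equation $$\Big(\frac{1}{f(\theta)}T''(\theta)\Big)'+\Big(\frac{\varepsilon-f^2(\theta)}{f(\theta)}\Big)T'(\theta)-\varepsilon\frac{f'(\theta)}{f^2(\theta)}T(\theta)=0,$$ where primes denote derivatives with respect to $\theta$.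
   Context: $E_1^3$ is $\mathbb{R}^3$ with the Lorentzian metric $g=-dx_1^2+dx_2^2+dx_3^2$. A vector $v$ is spacelike if $g(v,v)>0$ or $v=0$, timelike if $g(v,v)<0$, and null if $g(v,v)=0$ and $v\ne0$. A curve is spacelike if all its velocity vectors are spacelike. It is unit speed if its velocity $v$ satisfies $\sqrt{|g(v,v)|}=1$. All curves are smooth. For a unit speed spacelike curve $\psi(s)$ with spacelike or timelike principal normal $N$, the Frenet frame $\{T=\psi',N,B\}$, curvature $\kappa$ and torsion $\tau$ satisfy (with primes here denoting $d/ds$) $$T'=\kappa N,\qquad N'=-\varepsilon\kappa T+\tau B,\qquad B'=\tau N,$$ where $g(T,T)=1$, $g(N,N)=\varepsilon=\pm1$, $g(B,B)=-\varepsilon$, and $g(T,N)=g(T,B)=g(N,B)=0$. *)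

(* Defs.v *)
From mathcomp Require Import all_boot all_order all_algebra.
From mathcomp Require Import all_classical all_reals all_analysis.

Set Implicit Arguments.
Unset Strict Implicit.
Unset Printing Implicit Defensive.

Import Order.TTheory GRing.Theory Num.Theory.
Import numFieldNormedType.Exports.

Local Open Scope ring_scope.
Local Open Scope classical_set_scope.

(* The coordinates (x_1, x_2, x_3) of E_1^3 have indices 0, 1, 2 in 'I_3. *)
Definition lorentz (R : realType) (u v : 'rV[R]_3) : R :=
  - (u ord0 0 * v ord0 0) + u ord0 1 * v ord0 1 + u ord0 2%:R * v ord0 2%:R.

Definition spacelike (R : realType) (v : 'rV[R]_3) : Prop :=
  0 < lorentz v v \/ v = 0.

Definition timelike (R : realType) (v : 'rV[R]_3) : Prop :=
  lorentz v v < 0.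

(* Curves are total functions; only their values on the open interval I
   matter, and so do only the derivatives at points of I. *)
Definition smooth_on (R : realType) (I : set R) (psi : R -> 'rV[R]_3) : Prop :=
  forall (n : nat) (s : R), I s -> derivable (psi^`(n)) s 1.

Definition spacelike_curve (R : realType) (I : set R) (psi : R -> 'rV[R]_3) :
    Prop :=
  forall s : R, I s -> spacelike (psi^`()%classic s).

Definition unit_speed (R : realType) (I : set R) (psi : R -> 'rV[R]_3) : Prop :=
  forall s : R, I s ->
    Num.sqrt `|lorentz (psi^`()%classic s) (psi^`()%classic s)| = 1.

(* N s is spacelike when eps = 1 and timelike when eps = -1.  The Frenet
   equations include the differentiability of T, N and B; the differentiability
   of kappa and tau follows from them and from the smoothness of psi. *)
Record frenet_apparatus (R : realType) (I : set R) (psi T N B : R -> 'rV[R]_3)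
    (kappa tau : R -> R) (eps : R) : Prop := FrenetApparatus {
  frenet_eps : eps = 1 \/ eps = -1;
  frenet_normal : forall s, I s -> spacelike (N s) \/ timelike (N s);
  frenet_tangent : forall s, I s -> T s = psi^`()%classic s;
  frenet_TT : forall s, I s -> lorentz (T s) (T s) = 1;
  frenet_NN : forall s, I s -> lorentz (N s) (N s) = eps;
  frenet_BB : forall s, I s -> lorentz (B s) (B s) = - eps;
  frenet_TN : forall s, I s -> lorentz (T s) (N s) = 0;
  frenet_TB : forall s, I s -> lorentz (T s) (B s) = 0;
  frenet_NB : forall s, I s -> lorentz (N s) (B s) = 0;
  frenet_dT : forall s, I s -> is_derive s 1 T (kappa s *: N s);
  frenet_dN : forall s, I s ->
    is_derive s 1 N (- (eps * kappa s) *: T s + tau s *: B s);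
  frenet_dB : forall s, I s -> is_derive s 1 B (tau s *: N s)
}.

(* theta is an indefinite integral of h on I. *)
Definition antiderivative_on (R : realType) (I : set R) (theta h : R -> R) :
    Prop :=
  forall s : R, I s -> is_derive s 1 theta (h s).

(* The function s |-> F s on I, regarded as a function of the parameter
   theta = theta(s) ranging over theta @` I; pinv I theta is the inverse of the
   restriction of theta to I. *)
Definition reparam (R : realType) (V : Type) (I : set R) (theta : R -> R)
    (F : R -> V) : R -> V :=
  F \o pinv I theta.

(* Main.v *)
Require Import Defs.
From mathcomp Require Import all_boot all_order all_algebra.
From mathcomp Require Import all_classical all_reals all_analysis.
From mathcomp Require Import ring.

Import Order.TTheory GRing.Theory Num.Theory.
Import numFieldNormedType.Exports.

Local Open Scope ring_scope.
Local Open Scope classical_set_scope.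

(** Since theta' = kappa, differentiating along the reparametrized curve amounts
    to differentiating with respect to s and dividing by kappa.  Writing
    f = tau / kappa, the Frenet equations become, in the parameter theta,
      T' = N,   N' = - eps T + f B,   B' = f N.
    Hence T'' / f = B - (eps / f) T, and one more derivative gives
      (T'' / f)' = f N - (eps / f) N + eps (f' / f^2) T,
    which is the asserted equation because N = T'.

    Two points need an argument.
    - The change of parameter is licit: kappa has no zero, so by Rolle's theorem
      theta is injective on the interval I ([antiderivative_inj]); the inverse
      of theta is then differentiable on the open set theta(I), with derivative
      1 / kappa ([is_derive_reparam]).
    - The function f is differentiable, although the Frenet equations only speak
      of the derivatives of T, N and B.  Orthonormality expresses kappa and tau
      by differentiable functions: kappa = eps g(psi'', N), and
      psi''' = kappa' N + kappa N' gives tau = - eps g(psi''', B) / kappa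
      ([frenet_curvatureE], [frenet_torsionE]). *)

(** * Derivatives of vector-valued functions of one variable *)

Section DerivativesOfCurves.
Context {R : realType}.

Lemma is_derive1_derive1E {V : normedModType R} {F : R -> V} {x : R} {dF : V} :
  is_derive x 1 F dF -> F^`()%classic x = dF.
Proof. by move=> [_ <-]; rewrite derive1E. Qed.

(** Identities between curves are available on I or theta(I) only; since these
    sets are open, that is enough to transport derivatives. *)
Lemma is_derive_eq_on {V : normedModType R} {A : set R} {F G : R -> V} {x : R}
    {dF : V} :
  open A -> A x -> {in A, F =1 G} -> is_derive x 1 F dF -> is_derive x 1 G dF.
Proof.
move=> oA Ax FG; apply: near_eq_is_derive; near=> y; apply: FG.
by rewrite inE; near: y; exact: open_nbhs_nbhs.
Unshelve. all: by end_near. Qed.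

(** Reduces the product rules below, for the scaling of a vector and for the
    Lorentzian form, to the one for scalar functions. *)
Lemma is_derive_mxP {m n : nat} (M : R -> 'M[R]_(m, n)) (x : R) dM :
  is_derive x 1 M dM <-> forall i j, is_derive x 1 (fun y => M y i j) (dM i j).
Proof.
split=> [[dMx <-] i j|dMij].
  apply: DeriveDef; first exact: (derivable_mxP _ _ _).1.
  by rewrite derive_mx// mxE.
have dMx : derivable M x 1.
  by apply/derivable_mxP => i j; have [] := dMij i j.
apply: DeriveDef => //; rewrite derive_mx//.
by apply/matrixP => i j; rewrite mxE; have [] := dMij i j.
Qed.

Lemma is_derive_scale_mx {m n : nat} {k : R -> R} {M : R -> 'M[R]_(m, n)}
    {x dk : R} {dM} :
  is_derive x 1 k dk -> is_derive x 1 M dM ->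
  is_derive x 1 (fun y => k y *: M y) (k x *: dM + dk *: M x).
Proof.
move=> kx /is_derive_mxP Mx; apply/is_derive_mxP => i j.
rewrite (_ : (fun y => _) = k * (fun y => M y i j)); last first.
  by apply/funext => y; rewrite mxE.
by have Mij := Mx i j; apply: is_derive_eq; rewrite !mxE /GRing.scale/=; ring.
Qed.

Lemma is_derive_lorentz {u v : R -> 'rV[R]_3} {x : R} {du dv : 'rV[R]_3} :
  is_derive x 1 u du -> is_derive x 1 v dv ->
  is_derive x 1 (fun y => lorentz (u y) (v y))
    (lorentz du (v x) + lorentz (u x) dv).
Proof.
move=> /is_derive_mxP du' /is_derive_mxP dv'.
have dM i : is_derive x 1 (fun y => u y ord0 i * v y ord0 i)
    (du ord0 i * v x ord0 i + u x ord0 i * dv ord0 i).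
  apply: is_derive_eq (is_deriveM (du' ord0 i) (dv' ord0 i)) _.
  by rewrite /GRing.scale/= addrC mulrC.
apply: is_derive_eq
  (is_deriveD (is_deriveD (is_deriveN (dM 0)) (dM 1)) (dM 2%:R)) _.
(* The terms with du are the odd-numbered ones. *)
by rewrite /lorentz opprD (AC (2*2*2) ((1*3*5)*(2*4*6))).
Qed.

Lemma is_derive1_comp_curve {V : normedModType R} {F : R -> V} {p : R -> R}
    {x dp : R} {dF : V} :
  is_derive (p x) 1 F dF -> is_derive x 1 p dp ->
  is_derive x 1 (F \o p) (dp *: dF).
Proof.
move=> [dFx <-] [dpx <-].
have Fx := (derivable1_diffP _ _).1 dFx.
have px := (derivable1_diffP _ _).1 dpx.
have Fpx : differentiable (F \o p) x by exact: differentiable_comp.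
apply: DeriveDef; first exact/derivable1_diffP.
rewrite deriveE// diff_comp//= -(deriveE _ px).
by rewrite diff1E// derive1E.
Qed.

End DerivativesOfCurves.

(** * The Lorentzian form *)

Section LorentzForm.
Context {R : realType}.
Implicit Types u v w : 'rV[R]_3.

Lemma lorentzDl u v w : lorentz (u + v) w = lorentz u w + lorentz v w.
Proof. by rewrite /lorentz !mxE; ring. Qed.

Lemma lorentzZl (a : R) u v : lorentz (a *: u) v = a * lorentz u v.
Proof. by rewrite /lorentz !mxE; ring. Qed.

End LorentzForm.

(** * Reparametrization by an antiderivative of a nowhere zero function *)

Section Reparametrization.
Context {R : realType} {I : set R} {theta h : R -> R}.
Hypothesis I_open : open I.
Hypothesis I_interval : is_interval I.
Hypothesis theta_int : antiderivative_on I theta h.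
Hypothesis h_neq0 : forall s, I s -> h s != 0.

Lemma antiderivative_continuous s : I s -> {for s, continuous theta}.
Proof.
move=> Is; apply/differentiable_continuous/derivable1_diffP.
by have [] := theta_int _ Is.
Qed.

(** If theta took the same value at two points of I, its derivative h would
    vanish between them by Rolle's theorem, inside the interval I. *)
Lemma antiderivative_inj : {in I &, injective theta}.
Proof.
move=> a b; rewrite !inE.
wlog ab : a b / a < b => [wlog_ab|].
  have [ab|ba|//] := ltgtP a b => Ia Ib E; first exact: wlog_ab.
  by apply/esym; exact: wlog_ab.
move=> Ia Ib E; exfalso.
have Iab x : x \in `[a, b]%R -> I x.
  by rewrite in_itv/= => xab; exact: (I_interval _ _ Ia Ib).
have Iabo x : x \in `]a, b[%R -> I x.
  by move=> /subset_itv_oo_cc; exact: Iab.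
have [x xab|||c cab] := @Rolle R theta a b ab.
- by have [] := theta_int _ (Iabo x xab).
- apply: continuous_in_subspaceT => x; rewrite inE => xab.
  exact/antiderivative_continuous/Iab.
- by [].
move=> [_ dc0]; have [_ dch] := theta_int _ (Iabo _ cab).
by have := h_neq0 _ (Iabo _ cab); rewrite -dch dc0 eqxx.
Qed.

Lemma pinv_antiderivativeK s : I s -> pinv I theta (theta s) = s.
Proof.
move=> Is; have /(_ s) := @pinvKV _ _ (fun=> point) _ _ antiderivative_inj.
by apply; rewrite inE.
Qed.

Lemma reparamE {V : Type} (F : R -> V) s :
  I s -> reparam I theta F (theta s) = F s.
Proof. by move=> Is; rewrite /reparam/= pinv_antiderivativeK. Qed.

Lemma near_pinv_antiderivativeK s : I s ->
  {near s, cancel theta (pinv I theta)}.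
Proof.
move=> Is; near=> y; apply: pinv_antiderivativeK.
by near: y; exact: open_nbhs_nbhs.
Unshelve. all: by end_near. Qed.

Lemma near_antiderivative_continuous s : I s -> {near s, continuous theta}.
Proof.
move=> Is; near=> y; apply: antiderivative_continuous.
by near: y; exact: open_nbhs_nbhs.
Unshelve. all: by end_near. Qed.

(** The inverse p of theta is continuous at theta s, so a point t close to
    theta s has p t in I and is the image under theta of p t. *)
Lemma open_antiderivative_image : open (theta @` I).
Proof.
rewrite openE => _ [s Is <-].
have Ks := near_pinv_antiderivativeK _ Is.
have Cs := near_antiderivative_continuous _ Is.
have /nbhs_singleton Cp := near_can_continuous Ks Cs.
have Kt := near_continuous_can_sym Cs Ks.
rewrite /interior; near=> t; exists (pinv I theta t); last by near: t.
near: t; apply: Cp; rewrite /= pinv_antiderivativeK//.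
exact: open_nbhs_nbhs.
Unshelve. all: by end_near. Qed.

(** Chain rule and inverse function theorem: theta is continuous near s and has
    there the left inverse [pinv I theta], which is therefore differentiable at
    theta s with derivative 1 / h s. *)
Lemma is_derive_reparam {V : normedModType R} {F : R -> V} {s : R} {dF : V} :
  I s -> is_derive s 1 F dF ->
  is_derive (theta s) 1 (reparam I theta F) ((h s)^-1 *: dF).
Proof.
move=> Is Fs; apply: is_derive1_comp_curve.
  by rewrite pinv_antiderivativeK.
apply: is_derive_inverse (theta_int _ Is) (h_neq0 _ Is).
  exact: near_pinv_antiderivativeK.
exact: near_antiderivative_continuous.
Qed.

End Reparametrization.

(** * Differentiability of curvature and torsion *)

Section FrenetApparatus.
Context {R : realType} {I : set R} {psi T N B : R -> 'rV[R]_3}.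
Context {kappa tau : R -> R} {eps : R}.
Hypothesis I_open : open I.
Hypothesis psi_smooth : smooth_on I psi.
Hypothesis psi_frenet : frenet_apparatus I psi T N B kappa tau eps.

Lemma frenet_eps_sqr : eps * eps = 1.
Proof. by case: (frenet_eps psi_frenet) => ->; ring. Qed.

Lemma smooth_is_derive n s : I s ->
  is_derive s 1 (psi^`(n))%classic (psi^`(n.+1)%classic s).
Proof.
move=> Is; apply: DeriveDef; first exact: psi_smooth.
by rewrite derive1nS derive1E.
Qed.

Lemma frenet_derive2 s : I s -> psi^`(2)%classic s = kappa s *: N s.
Proof.
move=> Is; rewrite derive1nS derive1n1; apply: is_derive1_derive1E.
apply: (is_derive_eq_on I_open Is _ (frenet_dT psi_frenet Is)) => x.
by rewrite inE => Ix; rewrite (frenet_tangent psi_frenet).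
Qed.

(** A formula for kappa in terms of psi'' and N, both known to be
    differentiable. *)
Lemma frenet_curvatureE s :
  I s -> kappa s = eps * lorentz (psi^`(2)%classic s) (N s).
Proof.
move=> Is; rewrite frenet_derive2// lorentzZl (frenet_NN psi_frenet)//.
by rewrite mulrCA frenet_eps_sqr mulr1.
Qed.

Lemma derivable_frenet_curvature s : I s -> derivable kappa s 1.
Proof.
move=> Is.
have psi2_N := is_derive_lorentz (smooth_is_derive 2 _ Is)
  (frenet_dN psi_frenet Is).
have [] // := is_derive_eq_on (G := kappa) I_open Is _
  (is_deriveZ eps psi2_N).
by move=> x; rewrite inE => Ix; rewrite frenet_curvatureE.
Qed.

Lemma frenet_derive3 s : I s -> psi^`(3)%classic s =
  kappa s *: (- (eps * kappa s) *: T s + tau s *: B s) + 'D_1 kappa s *: N s.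
Proof.
move=> Is; rewrite derive1nS; apply: is_derive1_derive1E.
have dkN := is_derive_scale_mx
  (derivableP (derivable_frenet_curvature _ Is)) (frenet_dN psi_frenet Is).
apply: (is_derive_eq_on I_open Is _ dkN) => x.
by rewrite inE => Ix; rewrite frenet_derive2.
Qed.

(** Among the three components of psi''', only kappa tau B pairs nontrivially
    with B.  Using psi''' instead of N' makes the right-hand side visibly
    differentiable, since nothing is known about the second derivative of N. *)
Lemma frenet_torsionE s : I s -> kappa s != 0 ->
  tau s = - eps * (lorentz (psi^`(3)%classic s) (B s) / kappa s).
Proof.
move=> Is k0; rewrite frenet_derive3// !(lorentzDl, lorentzZl).
rewrite (frenet_TB psi_frenet)// (frenet_BB psi_frenet)//.
rewrite (frenet_NB psi_frenet)//.
transitivity (eps * eps * tau s); first by rewrite frenet_eps_sqr mul1r.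
by field.
Qed.

Hypothesis kappa_neq0 : forall s, I s -> kappa s != 0.

Lemma derivable_frenet_torsion s : I s -> derivable tau s 1.
Proof.
move=> Is.
have psi3_B := is_derive_lorentz (smooth_is_derive 3 _ Is)
  (frenet_dB psi_frenet Is).
have kV := is_deriveV (kappa_neq0 _ Is)
  (derivableP (derivable_frenet_curvature _ Is)).
have [] // := is_derive_eq_on (G := tau) I_open Is _
  (is_deriveZ (- eps) (is_deriveM psi3_B kV)).
move=> x; rewrite inE => Ix.
by rewrite (frenet_torsionE _ Ix (kappa_neq0 _ Ix)).
Qed.

End FrenetApparatus.

(** * The differential equation of the tangent *)

Theorem theorem3p1 (R : realType) (I : set R)
    (psi T N B : R -> 'rV[R]_3) (kappa tau theta : R -> R) (eps : R)
    (I_open : open I) (I_interval : is_interval I)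
    (psi_smooth : smooth_on I psi)
    (psi_spacelike : spacelike_curve I psi)
    (psi_unit_speed : unit_speed I psi)
    (psi_frenet : frenet_apparatus I psi T N B kappa tau eps)
    (kappa_neq0 : forall s : R, I s -> kappa s != 0)
    (tau_neq0 : forall s : R, I s -> tau s != 0)
    (theta_int : antiderivative_on I theta kappa) :
  let Tth : R -> 'rV[R]_3 := reparam I theta T in
  let f : R -> R := fun t => reparam I theta tau t / reparam I theta kappa t in
  let Tth1 : R -> 'rV[R]_3 := Tth^`()%classic in
  let Tth2 : R -> 'rV[R]_3 := Tth^`(2)%classic in
  let W : R -> 'rV[R]_3 := fun t => (f t)^-1 *: Tth2 t in
  forall t : R, (theta @` I) t ->
    [/\ derivable Tth t 1,
        derivable Tth1 t 1,
        derivable f t 1,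
        derivable W t 1 &
        W^`()%classic t
        + ((eps - f t ^+ 2) / f t) *: Tth1 t
        - (eps * (f^`()%classic t / f t ^+ 2)) *: Tth t = 0].
Proof.
move=> Tth f Tth1 Tth2 W.
have J_open := open_antiderivative_image I_open I_interval theta_int kappa_neq0.
have rE (V : Type) (F : R -> V) s (Is : I s) :=
  reparamE I_interval theta_int kappa_neq0 F s Is.
have dr (V : normedModType R) (F : R -> V) s dF (Is : I s) :=
  @is_derive_reparam _ _ _ _ I_open I_interval theta_int kappa_neq0 V F s dF Is.
have dTth s : I s -> is_derive (theta s) 1 Tth (N s).
  move=> Is; have := dr _ _ _ _ Is (frenet_dT psi_frenet Is).
  by rewrite scalerA mulVf ?kappa_neq0// scale1r.
have Tth1E : {in theta @` I, reparam I theta N =1 Tth1}.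
  move=> _ /set_mem[s Is <-]; rewrite rE//.
  by rewrite /Tth1 (is_derive1_derive1E (dTth s Is)).
have dTth1 s : I s -> is_derive (theta s) 1 Tth1
    ((kappa s)^-1 *: (- (eps * kappa s) *: T s + tau s *: B s)).
  move=> Is; apply: (is_derive_eq_on J_open _ Tth1E); first by exists s.
  exact: (dr _ _ _ _ Is (frenet_dN psi_frenet Is)).
pose g s := tau s / kappa s.
have g0 s : I s -> g s != 0 by move=> Is; rewrite mulf_neq0 ?invr_eq0; auto.
have dg s : I s -> is_derive s 1 g ('D_1 g s).
  move=> Is; apply/derivableP; apply: derivableM.
    exact: (derivable_frenet_torsion I_open psi_smooth psi_frenet).
  apply: derivableV; first exact: kappa_neq0.
  exact: (derivable_frenet_curvature I_open psi_smooth psi_frenet).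
have df s : I s -> is_derive (theta s) 1 f ((kappa s)^-1 *: 'D_1 g s).
  by move=> Is; exact: (dr _ _ _ _ Is (dg s Is)).
(* T'' / f expressed in the Frenet frame, as a function of s. *)
pose w s := B s - (eps / g s) *: T s.
have WE : {in theta @` I, reparam I theta w =1 W}.
  move=> _ /set_mem[s Is <-]; rewrite rE// /W /f !rE//.
  rewrite /Tth2 derive1nS derive1n1 (is_derive1_derive1E (dTth1 s Is)).
  apply/matrixP => i j; rewrite /w /g !mxE.
  by field; rewrite kappa_neq0 ?tau_neq0.
have dgV s : I s ->
    is_derive s 1 (fun s => eps / g s) (- (eps * 'D_1 g s / g s ^+ 2)).
  move=> Is.
  apply: is_derive_eq (is_deriveZ eps (is_deriveV (g0 s Is) (dg s Is))) _.
  by rewrite /GRing.scale/= mulNr mulrN mulrA mulrAC.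
have dW s : I s -> is_derive (theta s) 1 W
    ((kappa s)^-1 *: (tau s *: N s - ((eps / g s) *: (kappa s *: N s)
                      + (- (eps * 'D_1 g s / g s ^+ 2)) *: T s))).
  move=> Is; apply: (is_derive_eq_on J_open _ WE); first by exists s.
  apply: (dr _ _ _ _ Is); apply: is_deriveB (frenet_dB psi_frenet Is) _.
  exact: is_derive_scale_mx (dgV s Is) (frenet_dT psi_frenet Is).
move=> _ [s Is <-]; split.
- by have [] := dTth s Is.
- by have [] := dTth1 s Is.
- by have [] := df s Is.
- by have [] := dW s Is.
rewrite (is_derive1_derive1E (dW s Is)) (is_derive1_derive1E (df s Is)).
rewrite /Tth1 (is_derive1_derive1E (dTth s Is)) /Tth rE//.
rewrite (_ : f (theta s) = g s); last by rewrite /f !rE.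
apply/matrixP => i j; rewrite !mxE /GRing.scale/= /g.
by field; rewrite kappa_neq0 ?tau_neq0.
Qed.
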